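(* Let $n\in\mathbb{Z}^+$, $A\in\mathbb{R}^{n\times n}$, $b\in\mathbb{R}^{n}$ with $(A,b)$ controllable, and let $\mathcal{X}\subset\mathbb{R}^n$, $\mathcal{U}\subset\mathbb{R}$ be convex sets containing the origin. Consider the system $$x(k+1)=Ax(k)+bu(k),\qquad u\in\mathcal{U},\ x\in\mathcal{X}.$$ Let $Q\in\mathbb{R}^{n\times n}$ be symmetric positive definite and $R>0$. At each time $k=0,1,2,\dots$, given the current state $x(k)$, consider the optimization problem: minimize $$J(k)=\sum_{i=n}^{\infty}\left(\|x(i|k)\|_Q^2+\|u(i|k)\|_R^2\right)$$ over the sequences $(x(i|k))_{i\ge 0}$ in $\mathbb{R}^n$ and $(u(i|k))_{i\ge 0}$ in $\mathbb{R}$, subject to $$x(0|k)=x(k),\qquad x(i+1|k)=Ax(i|k)+bu(i|k),\qquad u(i|k)\in\mathcal{U},\qquad x(i+1|k)\in\mathcal{X},\qquad i=0,1,2,\dots$$ (the sum of stage costs starts at index $i=n$, the system dimension). Suppose that this problem is feasible at the initial time $k=0$, and that the control is implemented in receding-horizon fashion: at each time $k$, $u(k)=u^\ast(0|k)$, where $(u^\ast(i|k))_{i\ge0}$ is the control part of an optimal solution of the problem at time $k$. Then: 1) the optimization problem is recursively feasible, i.e. it is feasible at every time $k\ge 0$ along the closed-loop trajectory; 2) there exists a finite $T>0$ such that the closed-loop state satisfies $x(k)=0$ whenever $k>T$.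
   Context: Notation: $\|v\|_W^2=v^TWv$. The argument $(i|k)$ denotes the $i$-th step prediction made at time $k$. The optimization problem is called feasible at time $k$ if it admits a feasible solution, i.e. there are sequences satisfying all of its constraints for the given $x(k)$. The closed-loop trajectory is the sequence $x(k)$ generated by $x(k+1)=Ax(k)+bu(k)$ with $u(k)$ given by the receding-horizon law.
   Formalization: Part 2 additionally assumes the origin is an interior point of the sets X and U (false otherwise: n=1, A=1/2, b=1, U=[0,1], X=R, x(0)=1 gives x(k)=2^{-k}); an optimal solution is understood to have finite cost. *)

(* Defs.v *)
From HB Require Import structures.
From mathcomp Require Import all_boot all_order all_algebra.
From mathcomp Require Import all_classical all_reals all_analysis.

Set Implicit Arguments.
Unset Strict Implicit.
Unset Printing Implicit Defensive.

Import Order.TTheory GRing.Theory Num.Theory.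
Import numFieldNormedType.Exports.

Local Open Scope classical_set_scope.
Local Open Scope ring_scope.

Section SingleInputSystem.
Variables (R : realType) (n : nat).
Variables (A : 'M[R]_n) (b : 'cV[R]_n).

Definition trajectory (x : nat -> 'cV[R]_n) (u : nat -> R) : Prop :=
  forall i, x i.+1 = A *m x i + u i *: b.

(* Controllability in the state-transfer sense; no constraint sets involved. *)
Definition controllable : Prop :=
  forall x0 x1 : 'cV[R]_n, exists (N : nat) (x : nat -> 'cV[R]_n) (u : nat -> R),
    [/\ trajectory x u, x 0%N = x0 & x N = x1].

End SingleInputSystem.

Definition sqnorm (R : realType) (n : nat) (W : 'M[R]_n) (v : 'cV[R]_n) : R :=
  (v^T *m W *m v) 0 0.

Definition sym_posdef (R : realType) (n : nat) (W : 'M[R]_n) : Prop :=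
  W^T = W /\ forall v : 'cV[R]_n, v != 0 -> 0 < sqnorm W v.

Section PredictiveControl.
Variables (R : realType) (n : nat).
Variables (A : 'M[R]_n) (b : 'cV[R]_n) (X : set 'cV[R]_n) (U : set R).

(* The initial state itself is not required to lie in [X]. *)
Definition feasible_solution (x0 : 'cV[R]_n)
    (xs : nat -> 'cV[R]_n) (us : nat -> R) : Prop :=
  [/\ xs 0%N = x0, trajectory A b xs us,
      forall i, U (us i) & forall i, X (xs i.+1)].

Definition feasible (x0 : 'cV[R]_n) : Prop :=
  exists xs us, feasible_solution x0 xs us.

Variables (Q : 'M[R]_n) (r : R).

(* The input is scalar, so its weighted norm is [r * u ^+ 2]. The cost is
   extended-real valued since the series may diverge. *)
Definition cost (xs : nat -> 'cV[R]_n) (us : nat -> R) : \bar R :=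
  (\sum_(n <= i <oo) (sqnorm Q (xs i) + r * us i ^+ 2)%:E)%E.

(* The optimal value has to be finite: if every feasible solution costs +oo,
   the problem has no optimal solution, rather than all of them being optimal. *)
Definition optimal_solution (x0 : 'cV[R]_n)
    (xs : nat -> 'cV[R]_n) (us : nat -> R) : Prop :=
  [/\ feasible_solution x0 xs us, (cost xs us < +oo)%E &
      forall ys vs, feasible_solution x0 ys vs -> (cost xs us <= cost ys vs)%E].

(* The law prescribes [u k] only at the times where the problem is feasible, so
   that recursive feasibility is not part of the definition. At these times an
   optimal solution is assumed to exist ([X] and [U] need not be closed), and
   any one of them may be the one applied. *)
Definition closed_loop (x : nat -> 'cV[R]_n) (u : nat -> R) : Prop :=
  trajectory A b x u /\
  forall k, feasible (x k) ->
    exists xs us, optimal_solution (x k) xs us /\ u k = us 0%N.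

End PredictiveControl.

(* Main.v *)
(* The plan made at time k, with its first step dropped, is feasible at time
   k + 1. So the optimal cost drops by at least the stage cost at index n of the
   plan at time k, and these stage costs tend to 0: the planned states x(n|k) and
   x(n+1|k) tend to 0. The dropped plan and the new plan at k + 1 start at the
   same state, and both are close to 0 after n steps; since the controllability
   matrix is invertible, they are close to each other at all the steps between.
   Hence x(k+n) is close to x(n|k), and x(k) tends to 0. Once x(k) is small, a
   dead-beat plan respects the constraints, so the optimal cost is 0; then
   all the approximations are equalities, and x(k+n) = x(n|k) = 0. *)

Require Import Defs.
From HB Require Import structures.
From mathcomp Require Import all_boot all_order all_algebra.
From mathcomp Require Import all_classical all_reals all_analysis.
From mathcomp Require Import ring lra.

Set Implicit Arguments.
Unset Strict Implicit.
Unset Printing Implicit Defensive.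

Import Order.TTheory GRing.Theory Num.Theory.
Import numFieldNormedType.Exports.

Local Open Scope classical_set_scope.
Local Open Scope ring_scope.

(** * Quadratic forms of positive definite matrices *)

Lemma sqnormDZ (R : realType) n (Q : 'M[R]_n) (s t : R) (v w : 'cV[R]_n) :
  Q^T = Q -> sqnorm Q (s *: w + t *: v) =
  s ^+ 2 * sqnorm Q w + 2 * s * t * (w^T *m Q *m v) 0 0 + t ^+ 2 * sqnorm Q v.
Proof.
move=> Qsym; have vQw : (v^T *m Q *m w) 0 0 = (w^T *m Q *m v) 0 0.
  transitivity ((v^T *m Q *m w)^T 0 0); first by rewrite [RHS]mxE.
  by rewrite !trmx_mul trmxK Qsym mulmxA.
rewrite /sqnorm [(_ + _)^T]linearD/= ![(_ *: _)^T]linearZ/=.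
rewrite !mulmxDl !mulmxDr -!scalemxAl -!scalemxAr.
move: vQw; move: (w^T *m Q *m w) (w^T *m Q *m v) (v^T *m Q *m w).
move: (v^T *m Q *m v).
by move=> P P' P'' P''' vQw; rewrite !mxE vQw; ring.
Qed.

Lemma sym_posdef_unit (R : realType) n (Q : 'M[R]_n) :
  sym_posdef Q -> Q \in unitmx.
Proof.
move=> [_ Qpos]; rewrite unitmxE unitfE; apply/negP => /det0P[v v0 vQ].
have /Qpos : v^T != 0 by rewrite trmx_eq0.
by rewrite /sqnorm trmxK vQ mul0mx mxE ltxx.
Qed.

Lemma sqnorm0 (R : realType) n (Q : 'M[R]_n) : sqnorm Q 0 = 0.
Proof. by rewrite /sqnorm mulmx0 mxE. Qed.

Lemma sqnorm_ge0 (R : realType) n (Q : 'M[R]_n) v :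
  sym_posdef Q -> 0 <= sqnorm Q v.
Proof.
move=> [_ Qpos]; have [->|/Qpos/ltW//] := eqVneq v 0.
by rewrite sqnorm0.
Qed.

(* Cauchy-Schwarz for the inner product of Q, applied to Q^-1 e_i and v. *)
Lemma sqr_coord_le_sqnorm (R : realType) n (Q : 'M[R]_n) (i : 'I_n) :
  sym_posdef Q ->
  exists c, forall v : 'cV[R]_n, v i 0 ^+ 2 <= c * sqnorm Q v.
Proof.
move=> Qsp; have [Qsym Qpos] := Qsp.
pose w := invmx Q *m delta_mx i (0 : 'I_1).
have Qw : Q *m w = delta_mx i 0 by rewrite mulKVmx// sym_posdef_unit.
have w0 : w != 0.
  apply/eqP => w0; move/matrixP/(_ i 0): Qw; rewrite w0 mulmx0 !mxE !eqxx.
  by move/eqP; rewrite eq_sym oner_eq0.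
exists (sqnorm Q w) => v.
have wQv : (w^T *m Q *m v) 0 0 = v i 0.
  by rewrite -{1}Qsym -trmx_mul Qw trmx_delta -rowE mxE.
have := sqnorm_ge0 (v i 0 *: w + (- sqnorm Q w) *: v) Qsp.
have := Qpos _ w0.
(* The expanded form is [q * (q * p - v i 0 ^+ 2)], with [q > 0]. *)
rewrite sqnormDZ// wQv; set q := sqnorm Q w; set p := sqnorm Q v => q0 h.
rewrite -(ler_pM2l q0); nra.
Qed.

(** * Controllability matrix and Cayley-Hamilton *)

(** Kalman matrix with its columns reversed: column [j] is the effect of the input of time [j] on
    the state at time [n.+1]. *)
Definition ctrl_mx (R : realType) n (A : 'M[R]_n.+1) (b : 'cV[R]_n.+1) :
    'M[R]_n.+1 :=
  \matrix_(i, j) (A ^+ (n - j) *m b) i 0.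

Lemma mul_ctrl_mx (R : realType) n (A : 'M[R]_n.+1) (b d : 'cV[R]_n.+1) :
  ctrl_mx A b *m d = \sum_j d j 0 *: (A ^+ (n - j) *m b).
Proof.
apply/colP => i; rewrite mxE summxE; apply: eq_bigr => j _.
by rewrite !mxE mulrC.
Qed.

(** Variation of constants. The truncated [m.-1] is harmless: the sum is empty for [m = 0]. *)
Lemma trajectoryE (R : realType) n (A : 'M[R]_n.+1) (b : 'cV[R]_n.+1) x u m :
  trajectory A b x u ->
  x m = A ^+ m *m x 0%N + \sum_(j < m) u j *: (A ^+ (m.-1 - j) *m b).
Proof.
move=> xu; elim: m => [|m IH]; first by rewrite big_ord0 addr0 expr0 mul1mx.
rewrite xu IH big_ord_recr/= subnn expr0 mul1mx addrA mulmxDr mulmxA exprS.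
congr (_ + _ + _); rewrite mulmx_sumr; apply: eq_bigr => j _.
rewrite -scalemxAr mulmxA mulmxE -exprS; congr (_ *: (A ^+ _ *m b)).
by case: m j {IH} => [[]//|m] j /=; rewrite subSn// -ltnS.
Qed.

Lemma trajectory_ctrl_mx (R : realType) n (A : 'M[R]_n.+1) (b : 'cV[R]_n.+1)
    x u :
  trajectory A b x u ->
  x n.+1 = A ^+ n.+1 *m x 0%N + ctrl_mx A b *m \col_j u j.
Proof.
move=> xu; rewrite (trajectoryE _ xu)/= mul_ctrl_mx; congr (_ + _).
by apply: eq_bigr => j _; rewrite mxE.
Qed.

(** By Cayley-Hamilton, [p] can be reduced modulo the characteristic polynomial to degree at most
    [n]; the coefficients, in reverse order, are the entries of [d]. *)
Lemma horner_mx_ctrl_mx (R : realType) n (A : 'M[R]_n.+1) (b : 'cV[R]_n.+1)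
    (p : {poly R}) :
  exists d, horner_mx A p *m b = ctrl_mx A b *m d.
Proof.
pose q := p %% char_poly A.
have -> : horner_mx A p = horner_mx A q.
  rewrite [in LHS](divp_eq p (char_poly A)) rmorphD rmorphM/=.
  by rewrite Cayley_Hamilton mulr0 add0r.
have sq : (size q <= n.+1)%N.
  rewrite -ltnS -(size_char_poly A) ltn_modp -size_poly_eq0 size_char_poly//.
exists (\col_j q`_(n - j)); rewrite mul_ctrl_mx (reindex_inj rev_ord_inj)/=.
rewrite -[in LHS](take_poly_id sq) /take_poly poly_def.
rewrite linear_sum mulmx_suml; apply: eq_bigr => i _.
rewrite mxE linearZ/= rmorphXn/= horner_mx_X -scalemxAl subSS.
by rewrite subKn// leq_ord.
Qed.

Lemma reachable_horner_mx (R : realType) n (A : 'M[R]_n.+1) (b : 'cV[R]_n.+1)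
    x u m :
  trajectory A b x u -> x 0%N = 0 ->
  exists p : {poly R}, x m = horner_mx A p *m b.
Proof.
move=> xu x0; elim: m => [|m [p xm]].
  by exists 0; rewrite rmorph0 mul0mx.
exists ('X * p + (u m)%:P); rewrite xu xm rmorphD rmorphM/= horner_mx_X.
by rewrite horner_mx_C mulmxDl mul_scalar_mx mulmxA.
Qed.

(** Controllability leaves the transfer time free, but every state reached from 0 is a polynomial in
    [A] applied to [b], hence in the range of the matrix. Preimages of the basis vectors form a
    right inverse. *)
Lemma ctrl_mx_unit (R : realType) n (A : 'M[R]_n.+1) (b : 'cV[R]_n.+1) :
  controllable A b -> ctrl_mx A b \in unitmx.
Proof.
move=> ctrlAb.
have /choice[f fE] (v : 'cV[R]_n.+1) : exists d, v = ctrl_mx A b *m d.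
  have [N [x [u [xu x0 <-]]]] := ctrlAb 0 v.
  by have [p ->] := reachable_horner_mx N xu x0; exact: horner_mx_ctrl_mx.
have /mulmx1_unit[]// :
    ctrl_mx A b *m (\matrix_(i, j) f (delta_mx j 0) i 0) = 1%:M.
apply/matrixP => i j; have /colP/(_ i) := fE (delta_mx j 0).
rewrite !mxE eqxx andbT => ->; apply: eq_bigr => k _.
by rewrite !mxE.
Qed.

(** * Convergence to zero of vectors and stage costs *)

Lemma cvg_col0P (R : realType) n (v : nat -> 'cV[R]_n.+1) :
  v @ \oo --> (0 : 'cV[R]_n.+1) <-> forall i, v k i 0 @[k --> \oo] --> (0 : R).
Proof.
split=> [v0 i|v0].
  have := continuous_cvg _ (@coord_continuous R n.+1 1 i 0 0) v0.
  by rewrite mxE; apply.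
apply/cvg_ballP => e e0.
have : \forall k \near \oo, forall i, ball 0 e (v k i 0).
  apply: filter_forall => i; exact: (cvg_ball (v0 i)).
apply: filterS => k vk; split=> // i j; by rewrite mxE (ord1 j).
Qed.

Lemma cvg_mulmx0 (R : realType) m n (M : 'M[R]_(m.+1, n.+1)) v :
  v @ \oo --> (0 : 'cV[R]_n.+1) ->
  M *m v k @[k --> \oo] --> (0 : 'cV[R]_m.+1).
Proof.
move=> /cvg_col0P v0; apply/cvg_col0P => i.
under eq_fun do rewrite mxE.
have {1}-> : (0 : R) = \sum_(j < n.+1) M i j * 0.
  by rewrite big1// => j _; rewrite mulr0.
apply: cvg_big => [|j _]; first exact: add_continuous.
exact: cvgMl_tmp.
Qed.

Definition stage_cost (R : realType) n (Q : 'M[R]_n) (r : R) v (w : R) :=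
  sqnorm Q v + r * w ^+ 2.

Lemma stage_cost_ge0 (R : realType) n (Q : 'M[R]_n) (r : R) v w :
  sym_posdef Q -> 0 < r -> 0 <= stage_cost Q r v w.
Proof.
by move=> Qp r0; rewrite addr_ge0 ?sqnorm_ge0// mulr_ge0 ?sqr_ge0// ltW.
Qed.

Lemma stage_cost_eq0 (R : realType) n (Q : 'M[R]_n) (r : R) v w :
  sym_posdef Q -> 0 < r -> stage_cost Q r v w = 0 -> v = 0 /\ w = 0.
Proof.
move=> Qp r0; have rw0 : 0 <= r * w ^+ 2 by rewrite mulr_ge0 ?sqr_ge0// ltW.
move/eqP; rewrite paddr_eq0 ?sqnorm_ge0// mulf_eq0 (gt_eqF r0) sqrf_eq0.
move=> /andP[Qv0 /eqP w0]; split=> //.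
by apply/eqP; apply: contraLR Qv0 => /Qp.2 /gt_eqF ->.
Qed.

Lemma cvg_sqr0 (R : realType) (f : nat -> R) :
  f k ^+ 2 @[k --> \oo] --> (0 : R) -> f @ \oo --> (0 : R).
Proof.
move=> f0; apply/norm_cvg0P.
under eq_fun do rewrite -sqrtr_sqr.
have := continuous_cvg _ (@sqrt_continuous R 0) f0; rewrite sqrtr0; exact.
Qed.

Lemma stage_cost_cvg0 (R : realType) n (Q : 'M[R]_n.+1) (r : R) v w :
  sym_posdef Q -> 0 < r ->
  stage_cost Q r (v k) (w k) @[k --> \oo] --> (0 : R) ->
  v @ \oo --> (0 : 'cV[R]_n.+1) /\ w @ \oo --> (0 : R).
Proof.
move=> Qp r0 l0; split.
  apply/cvg_col0P => i; apply: cvg_sqr0.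
  have [c cP] := sqr_coord_le_sqnorm i Qp.
  (* The bound comes with no sign on [c]; testing it on a basis vector gives one. *)
  have c0 : 0 <= c.
    have d0 : delta_mx i 0 != 0 :> 'cV[R]_n.+1.
      apply/eqP => /colP/(_ i); rewrite !mxE !eqxx => /eqP.
      by rewrite oner_eq0.
    have := le_trans (sqr_ge0 _) (cP (delta_mx i 0)).
    by rewrite pmulr_lge0// Qp.2.
  have h : c * stage_cost Q r (v k) (w k) @[k --> \oo] --> (0 : R).
    by rewrite -(mulr0 c); exact: cvgMl_tmp.
  apply: (squeeze_cvgr _ (cvg_cst 0) h); apply: nearW => k.
  rewrite sqr_ge0/= (le_trans (cP _))// ler_wpM2l// lerDl.
  by rewrite mulr_ge0 ?sqr_ge0// ltW.
apply: cvg_sqr0.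
have h : r^-1 * stage_cost Q r (v k) (w k) @[k --> \oo] --> (0 : R).
  by rewrite -(mulr0 r^-1); exact: cvgMl_tmp.
apply: (squeeze_cvgr _ (cvg_cst 0) h); apply: nearW => k.
rewrite sqr_ge0/= mulrDr mulKf ?gt_eqF// lerDr mulr_ge0 ?sqnorm_ge0//.
by rewrite invr_ge0 ltW.
Qed.

Lemma cost_ge0 (R : realType) n (Q : 'M[R]_n) (r : R) xs us :
  sym_posdef Q -> 0 < r -> (0 <= cost Q r xs us)%E.
Proof.
by move=> Qp r0; apply: nneseries_ge0 => i _ _; rewrite lee_fin stage_cost_ge0.
Qed.

(** The sum for the shifted plan still starts at index [n], so it misses exactly stage [n] of the
    original plan. *)
Lemma cost_tail (R : realType) n (Q : 'M[R]_n) (r : R) xs us :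
  sym_posdef Q -> 0 < r ->
  cost Q r xs us = ((stage_cost Q r (xs n) (us n))%:E +
    cost Q r (fun i => xs i.+1) (fun i => us i.+1))%E.
Proof.
move=> Qp r0; have l0 ys (vs : nat -> R) i :
    (0 <= (sqnorm Q (ys i) + r * vs i ^+ 2)%:E)%E.
  by rewrite lee_fin; exact: stage_cost_ge0.
rewrite /cost (nneseries_split _ 1)// addn1 big_nat1; congr (_ + _)%E.
rewrite -nneseries_addn// -[RHS]nneseries_addn => [|i]; last first.
  exact: (l0 (fun i => xs i.+1) (fun i => us i.+1)).
by apply: eq_eseriesr => i _; rewrite addnS.
Qed.

Lemma feasible_solution_tail (R : realType) n (A : 'M[R]_n) b X U x0 xs us :
  feasible_solution A b X U x0 xs us ->
  feasible_solution A b X U (xs 1%N) (fun i => xs i.+1) (fun i => us i.+1).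
Proof.
move=> [xs0 xsus Uus Xxs]; split=> // i; exact: xsus.
Qed.

(** [J] is nonincreasing and bounded below, so it converges and its successive differences, which
    dominate [l], tend to 0. *)
Lemma nonincreasing_decrement_cvg0 (R : realType) (J l : nat -> R) :
  (forall k, 0 <= J k) -> (forall k, 0 <= l k) ->
  (forall k, J k.+1 + l k <= J k) -> l @ \oo --> (0 : R).
Proof.
move=> J0 l0 Jl.
have /cvg_ex[a Ja] : cvgn J.
  apply: nonincreasing_is_cvgn; last by exists 0 => _ [k _ <-].
  apply/nonincreasing_seqP => k.
  by rewrite (le_trans _ (Jl k))// lerDl.
have JSa : J k.+1 @[k --> \oo] --> a by rewrite cvg_shiftS.
have h : J k - J k.+1 @[k --> \oo] --> (0 : R).
  by rewrite -(subrr a); exact: cvgB.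
apply: (squeeze_cvgr _ (cvg_cst 0) h); apply: nearW => k.
by rewrite l0/= lerBrDl.
Qed.

Lemma trajectoryB (R : realType) n (A : 'M[R]_n) b xs us ys vs :
  trajectory A b xs us -> trajectory A b ys vs ->
  trajectory A b (fun i => xs i - ys i) (fun i => us i - vs i).
Proof.
by move=> xu yv i; rewrite xu yv mulmxBr scalerBl opprD addrACA.
Qed.

(** * Trajectories determined by their two end states *)

(** The inverse controllability matrix recovers the inputs linearly, hence continuously, from the
    two end states; the states between follow by the recursion. *)
Lemma transient_cvg0 (R : realType) n (A : 'M[R]_n.+1) (b : 'cV[R]_n.+1)
    (e : nat -> nat -> 'cV[R]_n.+1) (w : nat -> nat -> R) :
  ctrl_mx A b \in unitmx -> (forall k, trajectory A b (e k) (w k)) ->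
  e k 0%N @[k --> \oo] --> (0 : 'cV[R]_n.+1) ->
  e k n.+1 @[k --> \oo] --> (0 : 'cV[R]_n.+1) ->
  (forall i, (i <= n.+1)%N -> e k i @[k --> \oo] --> (0 : 'cV[R]_n.+1)) /\
  (forall i, (i < n.+1)%N -> w k i @[k --> \oo] --> (0 : R)).
Proof.
move=> Cunit ew e0 en.
have w0 i : (i < n.+1)%N -> w k i @[k --> \oo] --> (0 : R).
  move=> lti.
  have wE k : w k i =
      (invmx (ctrl_mx A b) *m (e k n.+1 - A ^+ n.+1 *m e k 0%N))
        (Ordinal lti) 0.
    by rewrite (trajectory_ctrl_mx (ew k)) addrC addKr mulKmx// mxE.
  under eq_fun do rewrite wE.
  have h : e k n.+1 - A ^+ n.+1 *m e k 0%N @[k --> \oo] --> (0 : 'cV[R]_n.+1).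
    by rewrite -(subr0 0); apply: cvgB => //; exact: cvg_mulmx0.
  have /cvg_col0P := cvg_mulmx0 (invmx (ctrl_mx A b)) h.
  exact.
split=> // i; elim: i => // i IH lti.
under eq_fun do rewrite ew.
rewrite -(addr0 0); apply: cvgD; first exact/cvg_mulmx0/IH/ltnW.
rewrite -(scale0r b); apply: cvgZr_tmp; exact: w0.
Qed.

(** The limit statement for a constant family: a constant sequence tending to 0 is 0. *)
Lemma transient_eq0 (R : realType) n (A : 'M[R]_n.+1) (b : 'cV[R]_n.+1) e w i :
  ctrl_mx A b \in unitmx -> trajectory A b e w ->
  e 0%N = 0 -> e n.+1 = 0 -> (i <= n.+1)%N -> e i = 0.
Proof.
move=> Cunit ew e0 en lei.
have [||+ _] := @transient_cvg0 _ _ _ _ (fun=> e) (fun=> w) Cunit (fun=> ew).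
- by rewrite e0; exact: cvg_cst.
- by rewrite en; exact: cvg_cst.
move=> /(_ i lei) h.
exact: (norm_cvg_unique (cvg_cst (e i)) h).
Qed.

(** * Dead-beat plans *)

Fixpoint rollout (R : realType) n (A : 'M[R]_n) (b x0 : 'cV[R]_n)
    (us : nat -> R) i :=
  if i is j.+1 then A *m rollout A b x0 us j + us j *: b else x0.

(** The first inputs cancel the free response [A ^+ n.+1 *m x0]; zero input then keeps the state at
    the origin. *)
Lemma deadbeat (R : realType) n (A : 'M[R]_n.+1) (b x0 : 'cV[R]_n.+1) :
  ctrl_mx A b \in unitmx ->
  exists xs us, [/\ trajectory A b xs us, xs 0%N = x0,
    forall i, (n < i)%N -> xs i = 0 & forall i, (n < i)%N -> us i = 0].
Proof.
move=> Cunit.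
pose d := - (invmx (ctrl_mx A b) *m (A ^+ n.+1 *m x0)).
(* The guard ensures that the default value of [inord] is never read. *)
pose us i := if (i < n.+1)%N then d (inord i) 0 else 0.
have us0 i : (n < i)%N -> us i = 0 by move=> lti; rewrite /us ltnS leqNgt lti.
have traj : trajectory A b (rollout A b x0 us) us by [].
exists (rollout A b x0 us), us; split=> // i.
elim: i => // i IH; rewrite ltnS leq_eqVlt => /orP[/eqP <-|lti].
  rewrite (trajectory_ctrl_mx traj) (_ : \col_j us j = d).
    by rewrite mulmxN mulKVmx// subrr.
  by apply/colP => j; rewrite mxE /us ltn_ord inord_val.
by rewrite /= IH// us0// mulmx0 scale0r addr0.
Qed.

Lemma cost_eq0 (R : realType) n (Q : 'M[R]_n) (r : R) xs us :
  (forall i, (n <= i)%N -> xs i = 0) -> (forall i, (n <= i)%N -> us i = 0) ->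
  cost Q r xs us = 0%E.
Proof.
move=> xs0 us0; apply: eseries0 => i lei _.
by rewrite xs0// us0// sqnorm0 expr0n mulr0 addr0.
Qed.

(** Both end states of the dead-beat transient tend to 0, so its finitely many values eventually
    enter [X] and [U]. The cost starts at index [n.+1] and sees only zeros. *)
Lemma near_deadbeat_feasible (R : realType) n (A : 'M[R]_n.+1) (b : 'cV[R]_n.+1)
    (X : set 'cV[R]_n.+1) (U : set R) (Q : 'M[R]_n.+1) (r : R) x :
  ctrl_mx A b \in unitmx -> interior X 0 -> interior U 0 ->
  x @ \oo --> (0 : 'cV[R]_n.+1) ->
  \forall k \near \oo, exists xs us,
    feasible_solution A b X U (x k) xs us /\ cost Q r xs us = 0%E.
Proof.
move=> Cunit X0 U0 x0.
have /choice[D DP] k := deadbeat (x k) Cunit.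
have {DP}/choice[V DV] k := DP k.
have traj k : trajectory A b (D k) (V k) by case: (DV k).
have Dk0 k : D k 0%N = x k by case: (DV k).
have Dkn k : D k n.+1 = 0 by case: (DV k) => _ _ ->.
have [||D0 V0] := transient_cvg0 Cunit traj.
- by under eq_fun do rewrite Dk0.
- by under eq_fun do rewrite Dkn; exact: cvg_cst.
have nX : \forall k \near \oo, forall i : 'I_n.+2, X (D k i).
  by apply: filter_forall => i; exact: (D0 i (ltn_ord i) _ X0).
have nU : \forall k \near \oo, forall i : 'I_n.+1, U (V k i).
  by apply: filter_forall => i; exact: (V0 i (ltn_ord i) _ U0).
near=> k; have [_ _ Dk Vk] := DV k.
exists (D k), (V k); split; last exact: cost_eq0.
split=> // i.
  have [lti|/Vk ->] := ltnP i n.+1; last exact: nbhs_singleton U0.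
  have : forall i : 'I_n.+1, U (V k i) by near: k.
  by move=> /(_ (Ordinal lti)).
have [lti|ltn] := ltnP i n.+1; last first.
  by rewrite Dk ?(leqW ltn)//; exact: nbhs_singleton X0.
have : forall i : 'I_n.+2, X (D k i) by near: k.
by move=> /(_ (@Ordinal n.+2 i.+1 lti)).
Unshelve. all: by end_near. Qed.

(** * Recursive feasibility *)

(** The law supplies a plan only at feasible times, hence the induction; the first planned state is
    the actual next state. *)
Lemma closed_loop_feasible (R : realType) n (A : 'M[R]_n) b X U Q r x u :
  feasible A b X U (x 0%N) -> closed_loop A b X U Q r x u ->
  forall k, feasible A b X U (x k).
Proof.
move=> feas0 [traj loop]; elim=> // k /loop[xs [us [[sol _ _] uk]]].
have [xs0 xsus _ _] := sol.
have <- : xs 1%N = x k.+1 by rewrite xsus traj uk xs0.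
by do 2 eexists; exact: feasible_solution_tail sol.
Qed.

(** * Convergence of the closed loop, then exact arrival at the origin *)

Section OptimalPlans.
Variables (R : realType) (n : nat).
Variables (A : 'M[R]_n.+1) (b : 'cV[R]_n.+1) (X : set 'cV[R]_n.+1) (U : set R).
Variables (Q : 'M[R]_n.+1) (r : R).
Hypotheses (Qpos : sym_posdef Q) (r_gt0 : 0 < r).
Hypothesis (Cunit : ctrl_mx A b \in unitmx).
Variables (x : nat -> 'cV[R]_n.+1).
Variables (xs : nat -> nat -> 'cV[R]_n.+1) (us : nat -> nat -> R).
Hypothesis opt : forall k, optimal_solution A b X U Q r (x k) (xs k) (us k).
Hypothesis xS : forall k, x k.+1 = xs k 1%N.

Let sol k : feasible_solution A b X U (x k) (xs k) (us k).
Proof. by case: (opt k). Qed.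

Let traj k : trajectory A b (xs k) (us k).
Proof. by case: (sol k). Qed.

Let xs0 k : xs k 0%N = x k.
Proof. by case: (sol k). Qed.

(** The first stage counted in the cost, as the dimension is [n.+1] here. *)
Let l k := stage_cost Q r (xs k n.+1) (us k n.+1).

(** The optimal cost acts as a Lyapunov function: the shifted plan competes at the next time and is
    cheaper by exactly [l k]. *)
Lemma optimal_stage_cvg0 : l @ \oo --> (0 : R).
Proof.
pose J k := fine (cost Q r (xs k) (us k)).
have JE k : ((J k)%:E = cost Q r (xs k) (us k))%E.
  rewrite fineK// ge0_fin_numE; first by case: (opt k).
  exact: cost_ge0.
apply: (@nonincreasing_decrement_cvg0 _ J) => k.
- by rewrite -lee_fin JE cost_ge0.
- exact: stage_cost_ge0.
rewrite -lee_fin EFinD !JE (cost_tail (xs k) (us k))// addeC leeD2l//.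
case: (opt k.+1) => _ _; apply.
by rewrite xS; exact: feasible_solution_tail (sol k).
Qed.

(** Gap between the shifted plan of time [k] and the plan of time [k.+1]; by linearity it is again a
    trajectory. *)
Let e k i := xs k i.+1 - xs k.+1 i.
Let w k i := us k i.+1 - us k.+1 i.

Let ew k : trajectory A b (e k) (w k).
Proof.
apply: trajectoryB => // i; exact: traj.
Qed.

Let e0 k : e k 0%N = 0. Proof. by rewrite /e xs0 xS subrr. Qed.

Lemma optimal_states_cvg0 : x @ \oo --> (0 : 'cV[R]_n.+1).
Proof.
have [xsn usn] := stage_cost_cvg0 Qpos r_gt0 optimal_stage_cvg0.
(* Needed for the end gap [e k n.+1], which is [xs k n.+2 - xs k.+1 n.+1]. *)
have xsn1 : xs k n.+2 @[k --> \oo] --> (0 : 'cV[R]_n.+1).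
  under eq_fun do rewrite traj.
  rewrite -(addr0 0); apply: cvgD; first exact: cvg_mulmx0.
  by rewrite -(scale0r b); apply: cvgZr_tmp.
have [||ei _] := transient_cvg0 Cunit ew.
- by under eq_fun do rewrite e0; exact: cvg_cst.
- rewrite -(subr0 0); apply: cvgB => //.
  by rewrite (cvg_shiftS (fun k => xs k n.+1)).
(* The difference telescopes into [e k i.-1], [e k.+1 i.-2], and so on: at most [n.+1] gaps, each
   tending to 0. *)
have xsx i : (i <= n.+1)%N ->
    xs k i - x (k + i)%N @[k --> \oo] --> (0 : 'cV[R]_n.+1).
  elim: i => [_|i IH lti].
    by under eq_fun do rewrite xs0 addn0 subrr; exact: cvg_cst.
  have eE k : xs k i.+1 - x (k + i.+1)%N = e k i + (xs k.+1 i - x (k.+1 + i)%N).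
    by rewrite /e addrA subrK addSnnS.
  under eq_fun do rewrite eE.
  rewrite -(addr0 0); apply: cvgD; first exact/ei/ltnW.
  by rewrite (cvg_shiftS (fun k => xs k i - x (k + i)%N)); exact/IH/ltnW.
rewrite -(cvg_shiftn n.+1).
have xE k : x (k + n.+1)%N = xs k n.+1 - (xs k n.+1 - x (k + n.+1)%N).
  by rewrite subKr.
under eq_fun do rewrite xE.
by rewrite -(subr0 0); apply: cvgB => //; exact: xsx.
Qed.

Lemma optimal_states_eq0 : interior X 0 -> interior U 0 ->
  exists K, forall k, (K <= k)%N -> x (k + n.+1)%N = 0.
Proof.
move=> X0 U0.
have [K _ Kdb] := near_deadbeat_feasible Q r Cunit X0 U0 optimal_states_cvg0.
exists K => k leKk.
have l0 j : (K <= j)%N -> xs j n.+1 = 0 /\ us j n.+1 = 0.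
  move=> leKj; apply: (stage_cost_eq0 Qpos r_gt0); apply/eqP.
  rewrite eq_le stage_cost_ge0// andbT -lee_fin.
  (* A competitor of cost 0 makes the optimal cost 0, and [l j] is one of its nonnegative terms. *)
  have [ys [vs [yv yv0]]] := Kdb _ leKj.
  case: (opt j) => _ _ /(_ _ _ yv); rewrite yv0; apply: le_trans.
  by rewrite cost_tail// leeDl// cost_ge0.
(* Time [j.+1] is also past [K], so both plans vanish at index [n.+1], and the earlier one stays at
   0 for one more step. *)
have ei j i : (K <= j)%N -> (i <= n.+1)%N -> e j i = 0.
  move=> leKj; apply: transient_eq0 (ew j) (e0 j) _ => //.
  have [xj uj] := l0 _ leKj; have [xj1 _] := l0 _ (leqW leKj).
  by rewrite /e traj xj uj xj1 mulmx0 scale0r addr0 subrr.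
have xsx i : (i <= n.+1)%N -> forall j, (K <= j)%N -> xs j i = x (j + i)%N.
  elim: i => [_ j _|i IH lti j leKj]; first by rewrite xs0 addn0.
  rewrite -addSnnS -IH ?leqW// ?(ltnW lti)//.
  by apply/eqP; rewrite -subr_eq0; apply/eqP/ei => //; exact: ltnW.
by rewrite -xsx//; case: (l0 k leKk).
Qed.

End OptimalPlans.

(* Part 2 asks for the origin to be an interior point of X and U: with the
   origin on the boundary it fails (n = 1, A = 1/2, b = 1, U = [0, 1], X = R
   gives x(k) = 2^-k x(0) for x(0) > 0). *)
Theorem theorem1 (R : realType) (n : nat) (n_gt0 : (0 < n)%N)
    (A : 'M[R]_n) (b : 'cV[R]_n) (ctrlAb : controllable A b)
    (X : set 'cV[R]_n) (U : set R)
    (convX : convex_set (M := 'cV[R]_n) X) (convU : convex_set (M := R^o) U)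
    (X0 : X 0) (U0 : U 0)
    (Q : 'M[R]_n) (Qpos : sym_posdef Q) (r : R) (r_gt0 : 0 < r)
    (x : nat -> 'cV[R]_n) (u : nat -> R)
    (feas0 : feasible A b X U (x 0%N)) (loop : closed_loop A b X U Q r x u) :
  (forall k, feasible A b X U (x k)) /\
  (interior X 0 -> interior U 0 ->
   exists T : nat, (0 < T)%N /\ forall k, (T < k)%N -> x k = 0).
Proof.
have feas := closed_loop_feasible feas0 loop.
split=> // X0' U0'; case: loop => traj loop.
have /choice[xs xsP] k := loop k (feas k).
have {xsP}/choice[us xsus] k := xsP k.
(* The preceding section works in dimension [n.+1]. *)
case: n n_gt0 A b ctrlAb X U convX convU X0 U0 Q Qpos x feas0 feas xs traj
  loop xsus X0' U0' => // n _ A b ctrlAb X U _ _ _ _ Q Qpos x _ _ xs traj _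
  xsus X0 U0.
have opt k : optimal_solution A b X U Q r (x k) (xs k) (us k).
  by case: (xsus k).
have xS k : x k.+1 = xs k 1%N.
  have [[[xk0 xsusk _ _] _ _] uk] := xsus k.
  by rewrite traj xsusk uk xk0.
have [K KP] :=
  optimal_states_eq0 Qpos r_gt0 (ctrl_mx_unit ctrlAb) opt xS X0 U0.
(* [K] bounds the planning time [k - n.+1], whence the shift. *)
exists (K + n.+1)%N; split=> [|k ltk]; first by rewrite addnS.
have ltnk : (n.+1 <= k)%N by rewrite (leq_trans (leq_addl K _))// ltnW.
by rewrite -(subnK ltnk); apply: KP; rewrite -(leq_add2r n.+1) subnK// ltnW.
Qed.
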